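(* Let $Q, A_1,A_2,A_3,A_4,B_1,B_2,B_3,B_4\in\mathbb{R}$ satisfy $B_1+B_2+A_3+A_4=Q+A_1+A_2+B_3+B_4$. Let $n_o\in\mathbb{Z}$, $\tilde{\mathfrak{y}}_o,\tilde{\mathfrak{z}}_o\in\{+1,-1\}$ and $y_o,z_o\in\mathbb{R}$. Then there exist sequences $(\mathfrak{y}_n,Y_n)_{n\in\mathbb{Z}}$ and $(\mathfrak{z}_n,Z_n)_{n\in\mathbb{Z}}$ with $\mathfrak{y}_n,\mathfrak{z}_n\in\{+1,-1\}$, $Y_n,Z_n\in\mathbb{R}$, such that $(\mathfrak{y}_{n_o},Y_{n_o})=(\tilde{\mathfrak{y}}_o,y_o)$, $(\mathfrak{z}_{n_o},Z_{n_o})=(\tilde{\mathfrak{z}}_o,z_o)$, and the ultradiscrete Painlevé VI equation with parity variables holds, i.e. for all $m\in\mathbb{Z}$ both $$\max\big[\max(A_1,A_2)+mQ+Y_m+B_3+B_4+S(\mathfrak{y}_m),\ \max(2Y_m,A_3+A_4)+Z_m+Z_{m+1}+S(\mathfrak{z}_m\mathfrak{z}_{m+1}),$$ $$\max(A_3,A_4)+Y_m+Z_m+Z_{m+1}+S(-\mathfrak{y}_m\mathfrak{z}_m\mathfrak{z}_{m+1})\big]$$ $$=\max\big[\max(2mQ+A_1+A_2,2Y_m)+B_3+B_4,\ \max(A_1,A_2)+mQ+Y_m+B_3+B_4+S(-\mathfrak{y}_m),$$ $$\max(2Y_m,A_3+A_4)+Z_m+Z_{m+1}+S(-\mathfrak{z}_m\mathfrak{z}_{m+1}),\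 \max(A_3,A_4)+Y_m+Z_m+Z_{m+1}+S(\mathfrak{y}_m\mathfrak{z}_m\mathfrak{z}_{m+1})\big]$$ and $$\max\big[\max(B_1,B_2)+mQ+Z_{m+1}+A_3+A_4+S(\mathfrak{z}_{m+1}),\ \max(2Z_{m+1},B_3+B_4)+Y_m+Y_{m+1}+S(\mathfrak{y}_m\mathfrak{y}_{m+1}),$$ $$\max(B_3,B_4)+Y_m+Y_{m+1}+Z_{m+1}+S(-\mathfrak{y}_m\mathfrak{y}_{m+1}\mathfrak{z}_{m+1})\big]$$ $$=\max\big[\max(2mQ+B_1+B_2,2Z_{m+1})+A_3+A_4,\ \max(B_1,B_2)+mQ+Z_{m+1}+A_3+A_4+S(-\mathfrak{z}_{m+1}),$$ $$\max(2Z_{m+1},B_3+B_4)+Y_m+Y_{m+1}+S(-\mathfrak{y}_m\mathfrak{y}_{m+1}),\ \max(B_3,B_4)+Y_m+Y_{m+1}+Z_{m+1}+S(\mathfrak{y}_m\mathfrak{y}_{m+1}\mathfrak{z}_{m+1})\big].$$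
   Context: The parity function $S:\{+1,-1\}\to\{0,-\infty\}$ is defined by $S(+1)=0$ and $S(-1)=-\infty$. Terms containing $S(-1)=-\infty$ are ignored in the maxima; that is, the equations are read in $\mathbb{R}\cup\{-\infty\}$ with $x+(-\infty)=-\infty$, and a maximum all of whose terms are $-\infty$ equals $-\infty$ (so an equation in which one side is $-\infty$ and the other contains a real term is not satisfied). *)

(* Defs.v *)
From HB Require Import structures.
From mathcomp Require Import all_boot all_order all_algebra.
From mathcomp Require Import reals constructive_ereal.
Set Implicit Arguments.
Unset Strict Implicit.
Unset Printing Implicit Defensive.
Import Order.TTheory GRing.Theory Num.Theory.
Local Open Scope ring_scope.

Definition is_sign (s : int) : Prop := s = 1 \/ s = -1.

(* Only meaningful on signs.  Since [+oo] never arises, adding [parityS R s] to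
   a real term is the addition of the max-plus semifield R U {-oo}. *)
Definition parityS (R : realType) (s : int) : \bar R :=
  if s == 1 then 0%E else -oo%E.

(* Main.v *)
Require Import Defs.
From HB Require Import structures.
From mathcomp Require Import all_boot all_order all_algebra.
From mathcomp Require Import reals constructive_ereal.
From mathcomp Require boolp.
From mathcomp Require Import ring lra.
Set Implicit Arguments.
Unset Strict Implicit.
Unset Printing Implicit Defensive.
Import Order.TTheory GRing.Theory Num.Theory.
Local Open Scope ring_scope.

(* For a given (sy m, Y m), the first equation constrains only the product
   sz m * sz (m + 1) and the sum Z m + Z (m + 1), and it always has a solution
   in these two unknowns.  Hence each of (sz m, Z m) and (sz (m + 1), Z (m + 1))
   can be chosen from the other.  The second equation behaves in the same way
   with the two sequences exchanged, so that the initial values propagate in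
   both directions. *)

(** Choice turns [fwd] and [bwd] into functions; iterating them from [s0] gives the two halves of
    the chain, and [P] is preserved along both. *)
Lemma int_chain (T : Type) (P : T -> Prop) (E : int -> T -> T -> Prop)
    (fwd : forall m s, P s -> exists2 t, P t & E m s t)
    (bwd : forall m t, P t -> exists2 s, P s & E m s t) (n0 : int) (s0 : T) :
  P s0 ->
  exists u : int -> T,
    [/\ u n0 = s0, forall m, P (u m) & forall m, E m (u m) (u (m + 1))].
Proof.
move=> Ps0.
have [f fP] : {f : int * T -> T
    & forall p, P p.2 -> P (f p) /\ E p.1 p.2 (f p)}.
  apply: (@boolp.choice _ _ (fun p t => P p.2 -> P t /\ E p.1 p.2 t)) => -[m s].
  (* Outside [P] nothing is required, so [s] serves as a dummy value. *)
  have [Ps|nPs] := boolp.pselect (P s); last by exists s.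
  by have [t] := fwd m s Ps; exists t.
have [g gP] : {g : int * T -> T
    & forall p, P p.2 -> P (g p) /\ E p.1 (g p) p.2}.
  apply: (@boolp.choice _ _ (fun p s => P p.2 -> P s /\ E p.1 s p.2)) => -[m t].
  have [Pt|nPt] := boolp.pselect (P t); last by exists t.
  by have [s] := bwd m t Pt; exists s.
pose up k := iteri k (fun i s => f (n0 + i%:Z, s)) s0.
(* [Negz i] is -(i + 1): the link between positions n0 - i - 1 and n0 - i is indexed by its left
   end. *)
pose down k := iteri k (fun i s => g (n0 + Negz i, s)) s0.
have Pup k : P (up k) by elim: k => //= k; case/(fP (n0 + k%:Z, _)).
have Pdown k : P (down k) by elim: k => //= k; case/(gP (n0 + Negz k, _)).
pose v k := match k with Posz i => up i | Negz i => down i.+1 end.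
exists (fun n => v (n - n0)); split => [|m|m].
- by rewrite subrr.
- by case: (m - n0) => k; [exact: Pup | exact: Pdown].
(* The offset -1 is treated apart: its link joins [down 1] to [s0], where the two halves meet. *)
rewrite addrAC -{1}(subrKC n0 m); case: (m - n0) => [k|[|k]].
- by rewrite -PoszD addn1; have [_] := fP (n0 + k%:Z, up k) (Pup k).
- by have [_] := gP (n0 + Negz 0, s0) Ps0.
have -> : Negz k.+1 + 1 = Negz k by rewrite !NegzE -[k.+2]addn1 PoszD opprD subrK.
by have [_] := gP (n0 + Negz k.+1, down k.+1) (Pdown k.+1).
Qed.

Lemma is_signM s t : is_sign s -> is_sign t -> is_sign (s * t).
Proof. by case=> -> [] ->; [left|right|right|left]. Qed.

(** Common shape of both equations: [s] is the sign of the term held fixed, whose value is absorbed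
    in [a], [b], [c], [d]; [(t, z)] and [(u, w)] are consecutive terms of the other sequence. *)
Definition ud_equation (R : realType) (a b c d : R) (s t u : int) (z w : R) :=
  maxe (a%:E + parityS R s)%E
   (maxe ((b + z + w)%R%:E + parityS R (t * u)%R)%E
         ((c + z + w)%R%:E + parityS R (- (s * t * u))%R)%E)
  = maxe d%:E
   (maxe (a%:E + parityS R (- s)%R)%E
   (maxe ((b + z + w)%R%:E + parityS R (- (t * u))%R)%E
         ((c + z + w)%R%:E + parityS R (s * t * u)%R)%E)).

Lemma ud_equationC (R : realType) (a b c d : R) s t u z w :
  ud_equation a b c d s t u z w -> ud_equation a b c d s u t w z.
Proof.
by rewrite /ud_equation -!(addrAC _ z w) (mulrC u t) -(mulrAC s t u).
Qed.

(** The sum [z + w] is chosen so that max(a, d) = max(b, c) + z + w; it remains to pick [t * u] so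
    that this common maximum occurs on both sides. *)
Lemma ud_equation_solvable (R : realType) (a b c d : R) (s t : int) (z : R) :
  is_sign s -> is_sign t ->
  exists2 p : int * R, is_sign p.1 & ud_equation a b c d s t p.1 z p.2.
Proof.
move=> hs ht.
(* [r] is the product [t * u]. If [s = 1], then [a] is on the left and [d] on the right, and [r]
   decides which of the [b] and [c] terms joins which side: the larger one must face the larger of
   [a], [d]. If [s = -1], then [r = 1] puts both on the left, against [a] and [d]. *)
pose r : int := if (s == 1) && ((a <= d) != (c <= b)) then -1 else 1.
have hr : is_sign r by rewrite /r; case: ifP; [right|left].
exists (r * t, Num.max a d - Num.max b c - z); first exact: is_signM.
have tt : t * (r * t) = r by case: ht => ->; ring.
rewrite /ud_equation -(mulrA s) /= tt.
have cancel x : x + z + (Num.max a d - Num.max b c - z)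
    = x + (Num.max a d - Num.max b c) by ring.
rewrite !cancel {tt cancel hr}/r.
case: hs => -> /=; rewrite /parityS;
  case: (leP a d) => had; case: (leP c b) => hcb /=;
  rewrite ?mulr1 ?mul1r ?mulrN1 ?opprK /= ?adde0 ?addeNy ?maxNye ?maxeNy
    -?EFin_max; congr (_%:E);
  rewrite /Num.max; repeat case: ltP => ?; lra.
Qed.

Theorem proposition1 (R : realType) (Q A1 A2 A3 A4 B1 B2 B3 B4 : R)
  (hAB : B1 + B2 + A3 + A4 = Q + A1 + A2 + B3 + B4)
  (no : int) (sy0 sz0 : int) (hsy0 : is_sign sy0) (hsz0 : is_sign sz0)
  (y0 z0 : R) :
  exists (sy : int -> int) (Y : int -> R) (sz : int -> int) (Z : int -> R),
    [/\ (forall n, is_sign (sy n)) /\ (forall n, is_sign (sz n)),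
        (sy no, Y no) = (sy0, y0),
        (sz no, Z no) = (sz0, z0)
      & forall m : int,
        maxe ((Num.max A1 A2 + m%:~R * Q + Y m + B3 + B4)%R%:E
                + parityS R (sy m))%E
       (maxe ((Num.max (2 * Y m) (A3 + A4) + Z m + Z (m + 1))%R%:E
                + parityS R (sz m * sz (m + 1))%R)%E
             ((Num.max A3 A4 + Y m + Z m + Z (m + 1))%R%:E
                + parityS R (- (sy m * sz m * sz (m + 1)))%R)%E)
        =
        maxe (Num.max (2 * m%:~R * Q + A1 + A2) (2 * Y m) + B3 + B4)%R%:E
       (maxe ((Num.max A1 A2 + m%:~R * Q + Y m + B3 + B4)%R%:E
                + parityS R (- sy m)%R)%E
       (maxe ((Num.max (2 * Y m) (A3 + A4) + Z m + Z (m + 1))%R%:E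
                + parityS R (- (sz m * sz (m + 1)))%R)%E
             ((Num.max A3 A4 + Y m + Z m + Z (m + 1))%R%:E
                + parityS R (sy m * sz m * sz (m + 1))%R)%E))
        /\
        maxe ((Num.max B1 B2 + m%:~R * Q + Z (m + 1) + A3 + A4)%R%:E
                + parityS R (sz (m + 1))%R)%E
       (maxe ((Num.max (2 * Z (m + 1)) (B3 + B4) + Y m + Y (m + 1))%R%:E
                + parityS R (sy m * sy (m + 1))%R)%E
             ((Num.max B3 B4 + Y m + Y (m + 1) + Z (m + 1))%R%:E
                + parityS R (- (sy m * sy (m + 1) * sz (m + 1)))%R)%E)
        =
        maxe (Num.max (2 * m%:~R * Q + B1 + B2) (2 * Z (m + 1)) + A3 + A4)%R%:E
       (maxe ((Num.max B1 B2 + m%:~R * Q + Z (m + 1) + A3 + A4)%R%:E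
                + parityS R (- sz (m + 1))%R)%E
       (maxe ((Num.max (2 * Z (m + 1)) (B3 + B4) + Y m + Y (m + 1))%R%:E
                + parityS R (- (sy m * sy (m + 1)))%R)%E
             ((Num.max B3 B4 + Y m + Y (m + 1) + Z (m + 1))%R%:E
                + parityS R (sy m * sy (m + 1) * sz (m + 1))%R)%E))].
Proof.
pose eqZ m sy y sz z sz' z' :=
  ud_equation (Num.max A1 A2 + m%:~R * Q + y + B3 + B4)
    (Num.max (2 * y) (A3 + A4)) (Num.max A3 A4 + y)
    (Num.max (2 * m%:~R * Q + A1 + A2) (2 * y) + B3 + B4) sy sz sz' z z'.
pose eqY m sz z sy y sy' y' :=
  ud_equation (Num.max B1 B2 + m%:~R * Q + z + A3 + A4)
    (Num.max (2 * z) (B3 + B4)) (Num.max B3 B4 + z)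
    (Num.max (2 * m%:~R * Q + B1 + B2) (2 * z) + A3 + A4) sz sy sy' y y'.
pose valid (x : (int * R) * (int * R)) := is_sign x.1.1 /\ is_sign x.2.1.
(* [eqY] involves the new z-term, so going forward z is updated before y, and going backward y
   before z. *)
pose step m (x x' : (int * R) * (int * R)) :=
  eqZ m x.1.1 x.1.2 x.2.1 x.2.2 x'.2.1 x'.2.2 /\
  eqY m x'.2.1 x'.2.2 x.1.1 x.1.2 x'.1.1 x'.1.2.
have fwd m x : valid x -> exists2 x', valid x' & step m x x'.
  case: x => [[sy y] [sz z]] [/= hy hz].
  have [[sz' z'] /= hz' eZ] : exists2 p, is_sign p.1 & eqZ m sy y sz z p.1 p.2.
    exact: ud_equation_solvable.
  have [[sy' y'] /= hy' eY] :
      exists2 p, is_sign p.1 & eqY m sz' z' sy y p.1 p.2.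
    exact: ud_equation_solvable.
  by exists ((sy', y'), (sz', z')).
have bwd m x' : valid x' -> exists2 x, valid x & step m x x'.
  case: x' => [[sy' y'] [sz' z']] [/= hy' hz'].
  have [[sy y] /= hy /ud_equationC eY] :
      exists2 p, is_sign p.1 & eqY m sz' z' sy' y' p.1 p.2.
    exact: ud_equation_solvable.
  have [[sz z] /= hz /ud_equationC eZ] :
      exists2 p, is_sign p.1 & eqZ m sy y sz' z' p.1 p.2.
    exact: ud_equation_solvable.
  by exists ((sy, y), (sz, z)).
have [//|u [u0 uP uE]] := int_chain fwd bwd no (s0 := ((sy0, y0), (sz0, z0))).
exists (fun n => (u n).1.1), (fun n => (u n).1.2).
exists (fun n => (u n).2.1), (fun n => (u n).2.2).
split; [by split=> n; case: (uP n) | by rewrite u0 | by rewrite u0 |] => m.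
have [eZ eY] := uE m; split; first exact: eZ.
move: eY; rewrite /eqY /ud_equation.
(* [ud_equation] puts the fixed sign and value before the pair, the stated second equation puts them
   last. *)
rewrite -!(mulrA (u (m + 1)).2.1) !(mulrC (u (m + 1)).2.1).
by rewrite !(addrAC _ (u (m + 1)).2.2).
Qed.
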